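(* Let $X$, $Y$ be Banach spaces and let $G\in L(X,Y)$ be a norm-one operator. Suppose that $B_{X_0}$ is an SCD set for every separable subspace $X_0\subset X$. Then $G$ has the alternative Daugavet property if and only if $G$ is lush.
   Context: Scalars are $\mathbb{K}=\mathbb{R}$ or $\mathbb{C}$; $\mathbb{T}=\{\omega\in\mathbb{K}:|\omega|=1\}$; subspaces are closed; $B_X$, $S_X$ are the closed unit ball and unit sphere; $\operatorname{aconv}(F)=\operatorname{conv}(\mathbb{T}F)$. $G\in L(X,Y)$ has the alternative Daugavet property if $\sup_{\omega\in\mathbb{T}}\|G+\omega T\|=1+\|T\|$ for every rank-one $T\in L(X,Y)$. A norm-one $G\in L(X,Y)$ is lush if for every $x_0\in B_X$, $\varepsilon>0$ and $y\in S_Y$ there is $F\subset B_X$ with $\operatorname{conv}(F)\subset\{x\in B_X:\|Gx+y\|>2-\varepsilon\}$ and $\operatorname{dist}(x_0,\operatorname{aconv}(F))<\varepsilon$. A slice of a bounded set $A\subset X$ is a set $\{x\in A:\operatorname{Re}x^*(x)>\sup_A\operatorname{Re}x^*-\alpha\}$ with $x^*\in X^*$, $\alpha>0$. A bounded set $A\subset X$ is slicely countably determined (SCD) if there is a countable family $\{S_n:n\in\mathbb{N}\}$ of slices of $A$ such that $A\subset\overline{\operatorname{conv}}(B)$ whenever $B\cap S_n\neq\emptyset$ for every $n\in\mathbb{N}$. *)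

(* Defs.v *)
From HB Require Import structures.
From mathcomp Require Import all_boot all_order all_algebra.
From mathcomp Require Import complex.
From mathcomp Require Import all_classical all_reals all_analysis.

Set Implicit Arguments.
Unset Strict Implicit.
Unset Printing Implicit Defensive.

Import Order.TTheory GRing.Theory Num.Theory.
Import numFieldNormedType.Exports.

Local Open Scope classical_set_scope.
Local Open Scope ring_scope.

Inductive scalar_kind := RealScalars | ComplexScalars.

Definition scalar_field (R : realType) (k : scalar_kind) : numFieldType :=
  match k with
  | RealScalars => R
  | ComplexScalars => R[i]
  end.

Definition scalar_re (R : realType) (k : scalar_kind) : scalar_field R k -> R :=
  match k return scalar_field R k -> R with
  | RealScalars => fun x => x
  | ComplexScalars => fun z => complex.Re z
  end.

(* The library norm takes values in the scalar field. It is always a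
   nonnegative real there; [rnorm] is the same number as an element of [R], so
   that suprema and infima can be taken in [R] or [\bar R]. *)
Definition rnorm (R : realType) (k : scalar_kind)
    (X : normedModType (scalar_field R k)) (x : X) : R :=
  scalar_re `|x|.

Section banach_notions.
Variables (R : realType) (k : scalar_kind).
Let K : numFieldType := scalar_field R k.

Definition unit_scalars : set K := [set w : K | `|w| = 1].

Definition unit_ball (X : normedModType K) : set X := [set x : X | `|x| <= 1].
Arguments unit_ball X : clear implicits.

Definition unit_sphere (X : normedModType K) : set X := [set x : X | `|x| = 1].
Arguments unit_sphere X : clear implicits.

Definition opnorm (X Y : normedModType K) (f : X -> Y) : R :=
  sup [set rnorm (f x) | x in unit_ball X].

Definition rank_one (X Y : normedModType K) (T : X -> Y) : Prop :=
  exists2 y : Y, y != 0 & range T = [set a *: y | a in [set: K]].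

Definition alternative_Daugavet (X Y : normedModType K) (G : X -> Y) : Prop :=
  forall T : {linear X -> Y}, continuous T -> rank_one T ->
    sup [set opnorm (fun x => G x + w *: T x) | w in unit_scalars]
    = 1 + opnorm T.

(* [convex_set] uses weights [0 <= t <= 1] in [K]; in [R[i]] the order makes
   such weights real. *)
Definition convex_hull (X : normedModType K) (A : set X) : set X :=
  smallest (fun C : set X => convex_set C) A.

Definition aconvex_hull (X : normedModType K) (F : set X) : set X :=
  convex_hull [set w *: x | w in unit_scalars & x in F].

(* Extended-real valued, so that the distance to the empty set is [+oo]. *)
Definition dist_to_set (X : normedModType K) (x : X) (A : set X) : \bar R :=
  ereal_inf [set (rnorm (x - z))%:E | z in A].

Definition lush (X Y : normedModType K) (G : X -> Y) : Prop :=
  forall (x0 : X) (e : R) (y : Y),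
    unit_ball X x0 -> 0 < e -> unit_sphere Y y ->
    exists F : set X,
      [/\ F `<=` unit_ball X,
          convex_hull F `<=` [set x | unit_ball X x /\ 2 - e < rnorm (G x + y)] &
          (dist_to_set x0 (aconvex_hull F) < e%:E)%E].

Definition is_slice (X : normedModType K) (A S : set X) : Prop :=
  exists (f : {linear X -> K^o}) (a : R),
    [/\ continuous f, 0 < a &
        S = [set x | A x /\
               sup [set scalar_re (f z) | z in A] - a < scalar_re (f x)]].

Definition SCD (X : normedModType K) (A : set X) : Prop :=
  bounded_set A /\
  exists S : nat -> set X,
    (forall n, is_slice A (S n)) /\
    (forall B : set X, (forall n, B `&` S n !=set0) -> A `<=` closure (convex_hull B)).

Definition closed_subspace (X : normedModType K) (X0 : set X) : Prop :=
  [/\ closed X0, X0 0 &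
      forall (a : K) (x y : X), X0 x -> X0 y -> X0 (a *: x + y)].

Definition separable_set (X : normedModType K) (A : set X) : Prop :=
  exists D : set X, [/\ countable D, D `<=` A & A `<=` closure D].

End banach_notions.

Arguments unit_ball {R k} X _.
Arguments unit_sphere {R k} X _.

(* Main.v *)
(* Lushness gives the alternative Daugavet property by a half-space argument:
   if a functional is nearly as large as possible somewhere on [aconv F], it is
   so at a unimodular multiple of a point of [F].

   Conversely, let [E u e] be the set of [x] in the unit ball with
   [|G x + u| > 1 + |u| - e]. By Hahn-Banach separation, the alternative
   Daugavet property says that [aconv (E u e)] is dense in the unit ball, and
   countably many points of [E u e] suffice near each point. Closing off
   countably often gives a separable closed subspace [X0] through [x0] such that
   the closure of [aconv (E (G z + y) e `&` X0)] contains the ball of [X0] for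
   all [z] in [X0]. Let the slices [S n] witness that this ball is SCD. One
   chooses inductively [x n] in [X0] and unimodular [w n] with [w n *: x n] in
   [S n] and [|G (x 0 + ... + x n) + y| > n + 2 - e]. By the triangle inequality
   every convex combination [v] of the [x n] satisfies [|G v + y| > 2 - e], and
   the SCD property puts [x0] in the closed convex hull of the [w n *: x n]. So
   [F = {x n}] works, and no weak-star compactness is needed. *)

Require Import Defs.
From HB Require Import structures.
From mathcomp Require Import all_boot all_order all_algebra.
From mathcomp Require Import complex ring lra.
From mathcomp Require Import all_classical all_reals all_analysis.

Set Implicit Arguments.
Unset Strict Implicit.
Unset Printing Implicit Defensive.

Import Order.TTheory GRing.Theory Num.Theory.
Import numFieldNormedType.Exports.

Local Open Scope classical_set_scope.
Local Open Scope ring_scope.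

(** * The Hahn-Banach theorem for a real sublinear functional *)

Section hahn_banach.
Variables (R : realType) (V : lmodType R) (p : V -> R).
Hypothesis pZ : forall (t : R) v, 0 <= t -> p (t *: v) = t * p v.
Hypothesis pD : forall v w, p (v + w) <= p v + p w.

Let p0 : p 0 = 0.
Proof. by rewrite -(scale0r 0) pZ// mul0r. Qed.

(* Linear forms dominated by [p] on a subspace, encoded by their graphs;
   domination makes such a graph functional. *)
Definition dominated_graph (g : set (V * R^o)) : Prop :=
  [/\ g 0, (forall a z z', g z -> g z' -> g (a *: z + z')) &
      forall z, g z -> z.2 <= p z.1].

Lemma dominated_graph_functional (g : set (V * R^o)) v r s :
  dominated_graph g -> g (v, r) -> g (v, s) -> r = s.
Proof.
case=> g0 glin gp.
suff le r' s' : g (v, r') -> g (v, s') -> s' <= r'.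
  by move=> gr gs; apply/eqP; rewrite eq_le !le.
move=> gr gs; have /gp/= := glin (-1) _ _ gr gs.
by rewrite !scaleN1r addNr p0 addrC subr_le0.
Qed.

Lemma dominated_graph_line (x : V) :
  dominated_graph [set (t *: x, t * p x) | t in [set: R]].
Proof.
split=> [|a _ _ [s _ <-] [t _ <-]|_ [t _ <-]]/=.
- by exists 0 => //; rewrite scale0r mul0r.
- by exists (a * s + t) => //; rewrite scalerDl mulrDl -scalerA -mulrA.
- have [t0|t0] := leP 0 t; first by rewrite pZ.
  (* For negative [t], use [0 = p 0 <= p (t *: x) + p (- t *: x)]. *)
  have := pD (t *: x) (- t *: x).
  rewrite -scalerDl subrr scale0r p0 [p (- t *: x)]pZ.
    by rewrite mulNr subr_ge0.
  by rewrite oppr_ge0 ltW.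
Qed.

(** The value [a] at [w] has to lie between all [z.2 - p (z.1 - w)] and all [p (z.1 + w) - z.2].
    Subadditivity puts the former below the latter, so the supremum of the former serves;
    homogeneity reduces other multiples of [w] to [w] and [- w]. *)
Lemma dominated_graph_extension (g : set (V * R^o)) (w : V) :
  dominated_graph g ->
  exists a : R, dominated_graph [set z + t *: (w, a) | z in g & t in [set: R]].
Proof.
move=> [g0 glin gp].
pose L : set R := [set z.2 - p (z.1 - w) | z in g].
have Lub z : g z -> ubound L (p (z.1 + w) - z.2).
  move=> gz _ [z' gz' <-].
  have : z.2 + z'.2 <= p (z.1 + z'.1).
    by have := gp _ (glin 1 _ _ gz gz'); rewrite scale1r.
  have := pD (z.1 + w) (z'.1 - w); rewrite addrACA subrr addr0 => h1 h2.
  by rewrite lerBlDr addrAC lerBrDr [leLHS]addrC; exact: le_trans h1.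
have L0 : L !=set0 by exists (0 - p (0 - w)), 0.
pose a := sup L.
have aL z : g z -> z.2 - p (z.1 - w) <= a.
  by move=> gz; apply: ub_le_sup; [exists (p (0 + w) - 0); exact: (Lub 0)|exists z].
have aU z : g z -> a <= p (z.1 + w) - z.2 by move=> /Lub; exact: ge_sup.
exists a; split=> [|b _ _ [z gz [s _ <-]] [z' gz' [t _ <-]]|_ [z gz [t _ <-]]]/=.
- by exists 0 => //; exists 0 => //; rewrite scale0r addr0.
- exists (b *: z + z'); first exact: glin.
  exists (b * s + t) => //.
  by rewrite scalerDr scalerDl -!scalerA [in RHS]addrACA.
- have gs c : g (c *: z) by rewrite -(addr0 (c *: z)); exact: glin.
  rewrite -[z.2 + _]/(z.2 + t * a : R).
  have [t0|t0|->] := ltgtP t 0; last first.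
  + by rewrite scale0r mul0r !addr0; exact: gp.
  + have : a <= p (t^-1 *: z.1 + w) - t^-1 * z.2 := aU _ (gs t^-1).
    rewrite -(ler_pM2l t0) mulrBr -(pZ _ (ltW t0)) scalerDr scalerA.
    by rewrite mulrA divff ?gt_eqF// scale1r mul1r lerBrDl.
  + have nt0 : 0 < - t by rewrite oppr_gt0.
    have : (- t)^-1 * z.2 - p ((- t)^-1 *: z.1 - w) <= a := aL _ (gs (- t)^-1).
    rewrite -(ler_pM2l nt0) mulrBr -(pZ _ (ltW nt0)) scalerBr scalerA.
    rewrite mulrA divff ?gt_eqF// scale1r mul1r scaleNr opprK mulNr.
    by rewrite lerBlDr addrC lerBrDr.
Qed.

(** Zorn's lemma gives a maximal dominated graph containing the line through [(x, p x)]. It is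
    total, because its extension to any [w] adds nothing to it. *)
Lemma hahn_banach (x : V) :
  exists u : {linear V -> R^o}, (forall v, u v <= p v) /\ u x = p x.
Proof.
pose line : set (V * R^o) := [set (t *: x, t * p x) | t in [set: R]].
pose P g := g = set0 \/ (dominated_graph g /\ line `<=` g).
have Pline : P line by right; split => //; exact: dominated_graph_line.
have [F FP Ftot|g [Pg gmax]] := @Zorn_bigcup _ P.
  have [->|/set0P[z0 [g0 Fg0 g0z]]] := eqVneq (\bigcup_(X in F) X) set0.
    by left.
  have FQ g z : F g -> g z -> dominated_graph g /\ line `<=` g.
    by move=> /FP[->//|].
  right; have [[g00 _ _] lg0] := FQ _ _ Fg0 g0z.
  split; last by move=> z /lg0 ?; exists g0.
  split=> [|a z z' [g Fg gz] [g' Fg' gz']|z [g Fg gz]].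
  - by exists g0.
  - have [gg'|g'g] := Ftot _ _ Fg Fg'.
    + have [[_ glin _] _] := FQ _ _ Fg' gz'.
      by exists g' => //; apply: glin => //; exact: gg'.
    + have [[_ glin _] _] := FQ _ _ Fg gz.
      by exists g => //; apply: glin => //; exact: g'g.
  - by have [[_ _ gp] _] := FQ _ _ Fg gz; exact: gp.
have linen0 : line !=set0 by exists (0 *: x, 0 * p x), 0.
have [g0|[gdom lineg]] : P g by [].
  have /gmax/(_ Pline) // : g `<` line.
  rewrite g0; split; first exact: sub0set.
  by case: linen0 => z lz /(_ _ lz).
have total w : exists r, g (w, r).
  have [a gadom] := dominated_graph_extension w gdom.
  set ga := (X in dominated_graph X) in gadom.
  have gga : g `<=` ga.
    by move=> z gz; exists z => //; exists 0 => //; rewrite scale0r addr0.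
  have [gag|] := pselect (ga `<=` g).
    exists a; apply: gag; exists 0; first by case: gdom.
    by exists 1 => //; rewrite add0r scale1r.
  move=> ngag; exfalso; apply: (gmax ga); first by split.
  by right; split => //; exact: subset_trans gga.
have [u ug] := choice total.
have ulin : linear (u : V -> R^o).
  move=> a v w; apply: (dominated_graph_functional gdom (ug _)).
  by case: gdom => _ glin _; exact: (glin a (v, u v) (w, u w)).
pose ulinear := GRing.isLinear.Build R V R^o _ u ulin.
pose U : {linear V -> R^o} := HB.pack u ulinear.
exists U; split=> [v|]; first by case: gdom => _ _ /(_ _ (ug v)).
apply: (dominated_graph_functional gdom (ug _)); apply: lineg.
by exists 1 => //; rewrite scale1r mul1r.
Qed.

End hahn_banach.

(** * Real and complex scalars treated uniformly *)

Definition scalar_inj (R : realType) (k : scalar_kind) : R -> scalar_field R k :=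
  match k return R -> scalar_field R k with
  | RealScalars => fun r => r
  | ComplexScalars => fun r => Complex r 0
  end.
Arguments scalar_inj {R k} _.

Section scalars.
Variables (R : realType) (k : scalar_kind).
Local Notation K := (scalar_field R k).
Implicit Types (r s t : R) (z w : K).

Lemma scalar_inj_is_zmod_morphism : zmod_morphism (@scalar_inj R k).
Proof. by case: k => r s //=; apply/eqP; rewrite eq_complex/= subr0 !eqxx. Qed.

Lemma scalar_inj_is_monoid_morphism : monoid_morphism (@scalar_inj R k).
Proof.
case: k; split => //= r s; apply/eqP; rewrite eq_complex/=.
by rewrite !(mulr0, mul0r, subr0, addr0) !eqxx.
Qed.

HB.instance Definition _ := GRing.isZmodMorphism.Build R K (@scalar_inj R k)
  scalar_inj_is_zmod_morphism.
HB.instance Definition _ := GRing.isMonoidMorphism.Build R K (@scalar_inj R k)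
  scalar_inj_is_monoid_morphism.

Lemma scalar_re_is_zmod_morphism : zmod_morphism (@scalar_re R k).
Proof. by case: k => // -[a b] [c d]. Qed.

HB.instance Definition _ := GRing.isZmodMorphism.Build K R (@scalar_re R k)
  scalar_re_is_zmod_morphism.

Lemma scalar_injK : cancel (@scalar_inj R k) (@scalar_re R k).
Proof. by case: k. Qed.

Lemma scalar_re_injM r z : scalar_re (scalar_inj r * z) = r * scalar_re z.
Proof. by case: k z => //= -[a b] /=; rewrite mul0r subr0. Qed.

Lemma scalar_reK z : 0 <= z -> scalar_inj (scalar_re z) = z.
Proof. by case: k z => //= -[a b]; rewrite lecE/= => /andP[/eqP->]. Qed.

Lemma ler_scalar_inj r s : (scalar_inj r <= scalar_inj s :> K) = (r <= s).
Proof. by case: k => //=; rewrite lecE/= eqxx. Qed.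

Lemma ltr_scalar_inj r s : (scalar_inj r < scalar_inj s :> K) = (r < s).
Proof. by case: k => //=; rewrite ltcE/= eqxx. Qed.

Lemma ler_scalar_re z w : z <= w -> scalar_re z <= scalar_re w.
Proof. by case: k z w => //= -[a b] [c d]; rewrite lecE/= => /andP[]. Qed.

Lemma scalar_re_le_norm z : scalar_re z <= scalar_re `|z|.
Proof.
case: k z => /= z; first exact: ler_norm.
by apply: le_trans (ler_norm _) _; have := normc_ge_Re z; rewrite lecE => /andP[].
Qed.

Lemma exists_scalar_phase z : exists2 w : K, `|w| = 1 & w * z = `|z|.
Proof.
have [->|z0] := eqVneq z 0; first by exists 1; rewrite ?normr1// normr0 mulr0.
exists (`|z| / z); last by rewrite divfK.
by rewrite normf_div normr_id divff ?normr_eq0.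
Qed.

(* Over [R[i]] the form with real part [u] is [v |-> u v - i u (i v)]. *)
Lemma exists_linear_re (X : lmodType K) (u : X -> R) :
  (forall v v', u (v + v') = u v + u v') ->
  (forall r v, u (scalar_inj r *: v) = r * u v) ->
  exists f : {linear X -> K^o}, forall v, scalar_re (f v) = u v.
Proof.
case: k X u => /= X u uD uZ.
  have ulin : linear (u : X -> R^o) by move=> r v w; rewrite uD uZ.
  pose ul := GRing.isLinear.Build R X R^o _ u ulin.
  by exists (HB.pack_for {linear X -> R^o} u ul).
pose f (v : X) : R[i]^o := Complex (u v) (- u ('i%C *: v)).
have flin : linear f.
  move=> [a b] v w; rewrite /f; apply/eqP; rewrite eq_complex/=.
  have scE c (x : X) d :
      Complex c d *: x = Complex c 0 *: x + Complex d 0 *: ('i%C *: x).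
    by rewrite scalerA -scalerDl; congr (_ *: _); simpc.
  have uN x : u (- x) = - u x.
    by rewrite -scaleN1r -[-1]/(Complex (-1) (- 0)) oppr0 uZ mulN1r.
  have ii (x : X) : 'i%C *: ('i%C *: x) = - x.
    by rewrite scalerA -scaleN1r; congr (_ *: _); simpc.
  rewrite !uD scalerDr !uD scE scalerDr !uD !uZ.
  have com c (x : X) : 'i%C *: (Complex c 0 *: x) = Complex c 0 *: ('i%C *: x).
    by rewrite !scalerA mulrC.
  rewrite !com !uZ ii uN; apply/andP; split; apply/eqP; ring.
pose fl := GRing.isLinear.Build R[i] X R[i]^o _ f flin.
by exists (HB.pack_for {linear X -> R[i]^o} f fl).
Qed.

(** Take scalars with rational real and imaginary parts; errors below [e / 2] in both parts keep the
    modulus of the difference below [e]. *)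
Lemma countable_dense_scalars : exists2 Q : set K, countable Q &
  forall z (e : R), 0 < e -> exists2 q, Q q & scalar_re `|z - q| < e.
Proof.
have dense (a e : R) : 0 < e -> exists q : rat, `|a - ratr q| < e.
  move=> e0; have /rat_in_itvoo[q] : a - e < a + e by lra.
  by rewrite inE/= => /andP[]; rewrite !bnd_simp => q1 q2; exists q; rewrite ltr_norml; lra.
case: k => /=.
  exists (range (ratr : rat -> R)) => [|z e /(dense z)[q zq]].
    exact: sub_countable (card_image_le _ _) (countableP _).
  by exists (ratr q) => //; exists q.
exists (range (fun q : rat * rat => Complex (ratr q.1 : R) (ratr q.2))).
  exact: sub_countable (card_image_le _ _) (countableP _).
move=> [a b] e e0.
have e2 : 0 < e / 2 by rewrite divr_gt0.
have [[p ap] [q bq]] := (dense a _ e2, dense b _ e2).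
exists (Complex (ratr p) (ratr q)); first by exists (p, q).
rewrite -[X in X < _]/(Num.sqrt (_ ^+ 2 + _ ^+ 2)) -[ltRHS]ger0_norm ?(ltW e0)// -sqrtr_sqr.
rewrite ltr_sqrt; last by rewrite exprn_gt0.
move: ap bq; set x := a - _; set y := b - _; rewrite !ltr_norml.
by move=> /andP[? ?] /andP[? ?]; nra.
Qed.
End scalars.

(** * Real-valued norms, closures and convex hulls *)

Section rnorm.
Variables (R : realType) (k : scalar_kind).
Local Notation K := (scalar_field R k).
Variable X : normedModType K.
Implicit Types (x y z : X) (a w : K) (r s t e : R) (A B : set X).

Lemma rnormE x : `|x| = scalar_inj (rnorm x) :> K.
Proof. by rewrite /rnorm scalar_reK. Qed.

Lemma rnorm_ge0 x : 0 <= rnorm x.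
Proof. by rewrite -(ler_scalar_inj k) raddf0 -rnormE. Qed.

Lemma rnorm0 : rnorm (0 : X) = 0.
Proof. by rewrite /rnorm normr0 raddf0. Qed.

Lemma rnorm_eq0 x : rnorm x = 0 -> x = 0.
Proof. by move=> x0; apply/eqP; rewrite -normr_eq0 rnormE x0 raddf0. Qed.

Lemma rnorm_gt0 x : x != 0 -> 0 < rnorm x.
Proof.
move=> x0; rewrite lt_neqAle rnorm_ge0 andbT eq_sym.
by apply: contra_neq x0; exact: rnorm_eq0.
Qed.

Lemma ler_rnormD x y : rnorm (x + y) <= rnorm x + rnorm y.
Proof. by rewrite -raddfD; exact/ler_scalar_re/ler_normD. Qed.

Lemma rnormN x : rnorm (- x) = rnorm x.
Proof. by rewrite /rnorm normrN. Qed.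

Lemma rnorm_distC x y : rnorm (x - y) = rnorm (y - x).
Proof. by rewrite -rnormN opprB. Qed.

Lemma ler_rnorm_dist x y : rnorm x <= rnorm y + rnorm (x - y).
Proof. by rewrite -{1}(subrK y x) addrC; exact: ler_rnormD. Qed.

Lemma rnormZ a x : rnorm (a *: x) = scalar_re `|a| * rnorm x.
Proof. by rewrite /rnorm normrZ -[`|a| in LHS]scalar_reK// scalar_re_injM. Qed.

Lemma norm_scalar_inj r : 0 <= r -> `|scalar_inj r : K| = scalar_inj r.
Proof. by move=> r0; rewrite ger0_norm// -(raddf0 scalar_inj) ler_scalar_inj. Qed.

Lemma rnormZ_inj r x : 0 <= r -> rnorm (scalar_inj r *: x) = r * rnorm x.
Proof. by move=> r0; rewrite rnormZ norm_scalar_inj// scalar_injK. Qed.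

Lemma rnormZ_unit w x : `|w| = 1 -> rnorm (w *: x) = rnorm x.
Proof. by move=> w1; rewrite rnormZ w1 -(rmorph1 scalar_inj) scalar_injK mul1r. Qed.

Lemma unit_ballE x : unit_ball X x <-> rnorm x <= 1.
Proof.
by rewrite /unit_ball/= rnormE -(rmorph1 scalar_inj) ler_scalar_inj.
Qed.

Lemma unit_sphereE x : unit_sphere X x <-> rnorm x = 1.
Proof.
rewrite /unit_sphere/= rnormE -(rmorph1 scalar_inj); split=> [|-> //].
by move/(congr1 (@scalar_re R k)); rewrite !scalar_injK.
Qed.

Lemma closure_rnorm A x :
  closure A x <-> forall e, 0 < e -> exists2 y, A y & rnorm (x - y) < e.
Proof.
split=> [Ax e e0|Ax B /nbhs_normP[e /= e0 Be]].
  have [|y [Ay]] := Ax (ball x (scalar_inj e)).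
    by apply: nbhsx_ballx; rewrite -(raddf0 scalar_inj) ltr_scalar_inj.
  rewrite -ball_normE/= rnormE ltr_scalar_inj => xy; by exists y.
have e0' : 0 < scalar_re e.
  by rewrite -(ltr_scalar_inj k) raddf0 scalar_reK ?ltW.
have [y Ay xy] := Ax _ e0'.
exists y; split => //; apply: Be; rewrite /ball_/= rnormE -(scalar_reK (ltW e0)).
by rewrite ltr_scalar_inj.
Qed.

Lemma convex_setE A : convex_set A <->
  forall x y t, A x -> A y -> 0 <= t -> t <= 1 ->
    A (scalar_inj t *: x + scalar_inj (1 - t) *: y).
Proof.
split=> [cA x y t Ax Ay t0 t1|cA x y l /set_mem Ax /set_mem Ay].
  have T0 : 0 <= scalar_inj t :> K by rewrite -(raddf0 scalar_inj) ler_scalar_inj.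
  have T1 : scalar_inj t <= 1 :> K by rewrite -(rmorph1 scalar_inj) ler_scalar_inj.
  have := cA x y (Itv01 T0 T1) (mem_set Ax) (mem_set Ay).
  by rewrite inE /conv/= /unstable.onem rmorphB rmorph1.
apply/mem_set; rewrite /conv/= /unstable.onem.
have l0 : 0 <= l%:num by [].
have l1 : l%:num <= 1 by [].
rewrite -(scalar_reK l0) -[X in X - _](rmorph1 scalar_inj) -rmorphB; apply: cA => //.
  by rewrite -(ler_scalar_inj k) raddf0 scalar_reK.
by have := ler_scalar_re l1;
  rewrite -[X in _ <= scalar_re X](rmorph1 scalar_inj) scalar_injK.
Qed.

Lemma convex_hull_convex A : convex_set (convex_hull A).
Proof.
move=> x y l /set_mem hx /set_mem hy; apply/mem_set => C [cC AC].
by apply/set_mem/cC; apply/mem_set; [exact: hx|exact: hy].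
Qed.

Lemma sub_convex_hull A : A `<=` convex_hull A.
Proof. exact: sub_gen_smallest. Qed.

Lemma convex_hull_min A B : convex_set B -> A `<=` B -> convex_hull A `<=` B.
Proof. exact: smallest_sub. Qed.

Lemma convex_hullS A B : A `<=` B -> convex_hull A `<=` convex_hull B.
Proof.
move=> AB; apply: convex_hull_min (subset_trans AB (@sub_convex_hull B)).
exact: convex_hull_convex.
Qed.

Lemma aconvex_hullS A B : A `<=` B -> aconvex_hull A `<=` aconvex_hull B.
Proof.
move=> AB; apply: convex_hullS => _ [w w1 [x Ax <-]].
by exists w => //; exists x => //; exact: AB.
Qed.

Lemma convex_unit_ball : convex_set (unit_ball X).
Proof.
apply/convex_setE => x y t /unit_ballE x1 /unit_ballE y1 t0 t1; apply/unit_ballE.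
by apply: le_trans (ler_rnormD _ _) _; rewrite !rnormZ_inj ?subr_ge0//; nra.
Qed.

(** Half-space argument: if [f <= c] on [A], then the convex set where [f <= c] contains the
    hull. *)
Lemma convex_hull_gt (f : X -> R) A x c :
  (forall v v', f (v + v') = f v + f v') ->
  (forall r v, f (scalar_inj r *: v) = r * f v) ->
  convex_hull A x -> c < f x -> exists2 y, A y & c < f y.
Proof.
move=> fD fZ Ax cx; apply: contrapT => /forall2NP nA.
suff /(_ x Ax) : convex_hull A `<=` [set y | f y <= c] by rewrite /= leNgt cx.
apply: convex_hull_min => [|y Ay/=]; last by case: (nA y) => // /negP; rewrite -leNgt.
apply/convex_setE => y z t /= yc zc t0 t1; rewrite fD !fZ.
by rewrite -subr_ge0 in t1; nra.
Qed.

Lemma dist_to_set_lt x A e :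
  (dist_to_set x A < e%:E)%E <-> exists2 z, A z & rnorm (x - z) < e.
Proof.
split=> [/ereal_inf_lt[_ [z Az <-]]|[z Az xz]]; first by rewrite lte_fin; exists z.
by apply: le_lt_trans (ereal_inf_lbound _) _; [by exists z|rewrite lte_fin].
Qed.

End rnorm.

(** * Continuity of linear maps through real bounds *)

Section linear_maps.
Variables (R : realType) (k : scalar_kind).
Local Notation K := (scalar_field R k).
Variables (X Y : normedModType K).

Lemma continuous_linear_rnorm (f : {linear X -> Y}) : continuous f ->
  exists2 M : R, 0 < M & forall x, rnorm (f x) <= M * rnorm x.
Proof.
move=> /linear_bounded_continuous/linear_boundedP/pinfty_ex_gt0[M M0 fM].
have M0' : 0 < scalar_re M.
  by rewrite -(ltr_scalar_inj k) raddf0 scalar_reK ?ltW.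
exists (scalar_re M) => // x; rewrite /rnorm -scalar_re_injM (scalar_reK (ltW M0)).
exact/ler_scalar_re.
Qed.

Lemma linear_rnorm_continuous (f : {linear X -> Y}) (M : R) :
  (forall x, rnorm (f x) <= M * rnorm x) -> continuous f.
Proof.
move=> fM; apply/linear_bounded_continuous/linear_boundedP.
exists (scalar_inj M); split=> [|r Mr x].
  (* The threshold has to be a real element of [K], that is, comparable with 0. *)
  by apply/orP; rewrite -(raddf0 scalar_inj) !ler_scalar_inj; exact/orP/le_total.
apply: (@le_trans _ _ (scalar_inj M * `|x|)); last by rewrite ler_wpM2r// ltW.
by rewrite !rnormE -rmorphM ler_scalar_inj.
Qed.

End linear_maps.

(** * Restriction of scalars to the reals, on an alias of the module *)

Definition real_restriction (R : realType) (k : scalar_kind)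
  (X : lmodType (scalar_field R k)) : Type := X.

Section real_restriction_lmodType.
Variables (R : realType) (k : scalar_kind) (X : lmodType (scalar_field R k)).
Local Notation XR := (real_restriction X).

HB.instance Definition _ := GRing.Zmodule.on XR.

Definition real_scale (r : R) (x : XR) : XR := (scalar_inj r *: (x : X)).

Lemma real_scaleA r s x : real_scale r (real_scale s x) = real_scale (r * s) x.
Proof. by rewrite /real_scale scalerA rmorphM. Qed.

Lemma real_scale1 : left_id 1 real_scale.
Proof. by move=> x; rewrite /real_scale rmorph1 scale1r. Qed.

Lemma real_scaleDr : right_distributive real_scale +%R.
Proof. by move=> r x y; rewrite /real_scale scalerDr. Qed.

Lemma real_scaleDl x : {morph real_scale^~ x : r s / r + s}.
Proof. by move=> r s; rewrite /real_scale rmorphD scalerDl. Qed.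

HB.instance Definition _ := GRing.Zmodule_isLmodule.Build R XR
  real_scaleA real_scale1 real_scaleDr real_scaleDl.

End real_restriction_lmodType.

(** * Separation of a point from a convex set *)

Section separation.
Variables (R : realType) (k : scalar_kind).
Local Notation K := (scalar_field R k).
Variables (X : normedModType K) (C : set X).
Hypotheses (convC : convex_set C) (C0 : C 0).

Variable M : R.
Hypothesis M0 : 0 <= M.

(** Costs of writing [v] as a multiple [t] of a point of [C] plus a remainder: [t] for the multiple
    and [M] times the norm for the remainder. *)
Let S (v : X) : set R := [set q | exists t c,
  [/\ 0 <= t, C c & q = t + M * rnorm (v - scalar_inj t *: c)]].

Let S_lbound v : lbound (S v) 0.
Proof. by move=> _ [t [c [t0 _ ->]]]; rewrite addr_ge0// mulr_ge0// rnorm_ge0. Qed.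

Let S_ex v : S v (M * rnorm v).
Proof. by exists 0, 0; split=> //; rewrite scaler0 subr0 add0r. Qed.

(* The largest sublinear functional with [p <= 1] on [C] and [p <= M |.|]. *)
Definition hull_gauge (v : X) : R := inf (S v).

Local Notation p := hull_gauge.

Lemma hull_gauge_le v t c : 0 <= t -> C c ->
  p v <= t + M * rnorm (v - scalar_inj t *: c).
Proof.
by move=> t0 Cc; apply: ge_inf; [exists 0; exact: S_lbound|exists t, c].
Qed.

Lemma le_hull_gauge v a :
  (forall t c, 0 <= t -> C c -> a <= t + M * rnorm (v - scalar_inj t *: c)) -> a <= p v.
Proof.
move=> av; apply: lb_le_inf; first by exists (M * rnorm v); exact: S_ex.
by move=> _ [t [c [t0 Cc ->]]]; exact: av.
Qed.

Lemma hull_gauge_le_rnorm v : p v <= M * rnorm v.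
Proof. by have := hull_gauge_le v (lexx 0) C0; rewrite scaler0 subr0 add0r. Qed.

Lemma hull_gauge_le1 v : C v -> p v <= 1.
Proof.
move=> Cv; have := hull_gauge_le v ler01 Cv.
by rewrite rmorph1 scale1r subrr rnorm0 mulr0 addr0.
Qed.

Lemma hull_gauge0 : p 0 = 0.
Proof.
apply/eqP; rewrite eq_le; apply/andP; split.
  by have := hull_gauge_le_rnorm 0; rewrite rnorm0 mulr0.
by apply: le_hull_gauge => t c t0 _; rewrite addr_ge0// mulr_ge0// rnorm_ge0.
Qed.

Lemma hull_gaugeZ (s : R) v : 0 <= s -> p (scalar_inj s *: v) = s * p v.
Proof.
have le (r : R) w : 0 < r -> p (scalar_inj r *: w) <= r * p w.
  move=> r0; rewrite -ler_pdivrMl//; apply: le_hull_gauge => t c t0 Cc.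
  rewrite ler_pdivrMl//; have := hull_gauge_le (scalar_inj r *: w) (mulr_ge0 (ltW r0) t0) Cc.
  by rewrite rmorphM -scalerA -scalerBr rnormZ_inj ?(ltW r0)// mulrDr mulrCA.
rewrite le_eqVlt => /predU1P[<-|s0]; first by rewrite raddf0 scale0r mul0r hull_gauge0.
apply/eqP; rewrite eq_le le//= -ler_pdivlMl//.
have := le s^-1 (scalar_inj s *: v).
by rewrite scalerA -rmorphM mulVf ?gt_eqF// rmorph1 scale1r; apply; rewrite invr_gt0.
Qed.

(** By convexity, [t] times [c] plus [s] times [d] is [t + s] times a point of [C], and the
    remainders add up. *)
Lemma hull_gaugeD v w : p (v + w) <= p v + p w.
Proof.
rewrite -lerBlDr; apply: le_hull_gauge => t c t0 Cc.
rewrite lerBlDr -lerBlDl; apply: le_hull_gauge => s d s0 Cd.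
rewrite lerBlDl.
have [st|st] := eqVneq (t + s) 0.
  have -> : t = 0 by lra.
  have -> : s = 0 by lra.
  rewrite !raddf0 !scale0r !subr0 !add0r; apply: le_trans (hull_gauge_le_rnorm _) _.
  by rewrite -mulrDr ler_wpM2l// ler_rnormD.
have ts0 : 0 < t + s by rewrite lt_neqAle eq_sym st addr_ge0.
have Ccd : C (scalar_inj (t / (t + s)) *: c + scalar_inj (1 - t / (t + s)) *: d).
  move/convex_setE : convC; apply => //; first by rewrite divr_ge0// addr_ge0.
  by rewrite ler_pdivrMr// mul1r lerDl.
apply: le_trans (hull_gauge_le _ (addr_ge0 t0 s0) Ccd) _.
rewrite addrACA lerD2l -mulrDr ler_wpM2l//.
apply: le_trans (ler_rnormD _ _); rewrite le_eqVlt; apply/predU1P; left.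
congr rnorm; rewrite scalerDr !scalerA -!rmorphM mulrBr mulr1 mulrCA divff// mulr1.
by rewrite [t + s]addrC addrK opprD addrACA.
Qed.

End separation.

(** Apply Hahn-Banach at [x] to the gauge, with [M] so large, compared with the distance from [x] to
    [C], that the gauge exceeds 1 at [x]. *)
Lemma convex_separation (R : realType) (k : scalar_kind)
    (X : normedModType (scalar_field R k)) (C : set X) (x : X) :
  convex_set C -> C 0 -> ~ closure C x ->
  exists f : {linear X -> (scalar_field R k)^o},
    [/\ continuous f, forall v, C v -> scalar_re (f v) <= 1 & 1 < scalar_re (f x)].
Proof.
move=> convC C0 /closure_rnorm/existsNP[e /not_implyP[e0 xC]].
have {}xC y : C y -> e <= rnorm (x - y).
  by move=> Cy; rewrite leNgt; apply/negP => xy; apply: xC; exists y.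
(* With this [M], a remainder of norm at least [e / 2] costs at least 2. *)
pose M := 4 / e; have M0 : 0 <= M by rewrite divr_ge0// ltW.
pose p := hull_gauge C M.
have [|u [up ux]] := @hahn_banach R (real_restriction X) p _ (hull_gaugeD convC C0 M0) x.
  by move=> t v t0; exact: hull_gaugeZ.
have [f fu] := @exists_linear_re R k X u (raddfD u) (fun r v => linearZ_LR u r v).
have fM v : rnorm (f v : _^o) <= M * rnorm v.
  (* The gauge dominates only the real part of [f]; rotating [v] turns [f v] into its modulus. *)
  have [w w1 wf] := exists_scalar_phase (f v).
  rewrite /rnorm -wf -[w * _]/(w *: f v) -linearZ fu.
  apply: le_trans (up _) _; apply: le_trans (hull_gauge_le_rnorm C0 M0 _) _.
  by rewrite rnormZ_unit.
exists f; split; first exact: linear_rnorm_continuous fM.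
  by move=> v Cv; rewrite fu; apply: le_trans (up _) _; exact: hull_gauge_le1.
(* The gauge at [x] is at least [1 + d]. For [t <= 1] the multiple of [c] lies in [C], so the
   remainder has norm at least [e]. For [t >= 1 + d] the term [t] suffices. In between, [t] times
   [x] is within [e / 2] of [x], so the remainder has norm at least [e / 2]. *)
rewrite fu ux; pose d := Num.min 1 (e / (2 * (1 + rnorm x))).
have x1 : 0 < 1 + rnorm x by rewrite ltr_pwDl// rnorm_ge0.
have d0 : 0 < d by rewrite lt_min ltr01 divr_gt0// mulr_gt0.
have d1 : d <= 1 by rewrite ge_min lexx.
have dx : d * (2 * (1 + rnorm x)) <= e.
  by rewrite -ler_pdivlMr ?mulr_gt0// ge_min lexx orbT.
apply: (@lt_le_trans _ _ (1 + d)); first by rewrite ltrDl.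
apply: le_hull_gauge => // t c t0 Cc.
have Me : M * e = 4 by rewrite /M divfK// gt_eqF.
have x0 := rnorm_ge0 x; have y0 := rnorm_ge0 (x - scalar_inj t *: c).
have [t1|t1] := leP t 1.
  have := xC (scalar_inj t *: c); rewrite -(addr0 (scalar_inj t *: c)).
  rewrite -{1}(scaler0 _ (scalar_inj (1 - t))) => /(_ _)/wrap[|ex].
    by move/convex_setE : convC; apply.
  by have := ler_wpM2l M0 ex; rewrite addr0; lra.
have [td|td] := leP (1 + d) t; first by rewrite (le_trans td)// lerDl mulr_ge0.
have ec := xC _ Cc.
have : e <= t * rnorm (x - c) by nra.
rewrite -(rnormZ_inj (x - c) (ltW (lt_trans ltr01 t1))) scalerBr => h.
have := ler_rnorm_dist (scalar_inj t *: x - scalar_inj t *: c) (x - scalar_inj t *: c).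
rewrite opprB addrA subrK.
have -> : scalar_inj t *: x - x = scalar_inj (t - 1) *: x.
  by rewrite rmorphB rmorph1 scalerBl scale1r.
have t1' : 0 <= t - 1 by rewrite subr_ge0 ltW.
rewrite rnormZ_inj// => h'.
have : e / 2 <= rnorm (x - scalar_inj t *: c) by nra.
by move=> /(ler_wpM2l M0); rewrite [M * (e / 2)]mulrA Me; lra.
Qed.

(** * Operator norms as suprema over the unit ball *)

Section operator_norm.
Variables (R : realType) (k : scalar_kind).
Local Notation K := (scalar_field R k).
Variables X Y : normedModType K.
Implicit Types (f : X -> Y) (c M : R).

(** The constant [M] makes the values on the ball bounded above, as a real [sup] requires. *)
Lemma opnorm_ge f M x : (forall v, rnorm (f v) <= M * rnorm v) ->
  rnorm x <= 1 -> rnorm (f x) <= opnorm f.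
Proof.
move=> fM x1; apply: ub_le_sup; last by exists x => //; exact/unit_ballE.
exists `|M| => _ [v /unit_ballE v1 <-]; apply: le_trans (fM v) _.
by have := rnorm_ge0 v; have := ler_norm M; have := normr_ge0 M; nra.
Qed.

Lemma unit_ball_image0 f : [set rnorm (f x) | x in unit_ball X] !=set0.
Proof. by exists (rnorm (f 0)), 0 => //; apply/unit_ballE; rewrite rnorm0. Qed.

Lemma opnorm_le f c : (forall x, rnorm x <= 1 -> rnorm (f x) <= c) -> opnorm f <= c.
Proof.
move=> fc; apply: ge_sup; first exact: unit_ball_image0.
by move=> _ [v /unit_ballE v1 <-]; exact: fc.
Qed.

Lemma lt_opnorm f c : c < opnorm f -> exists2 x, rnorm x <= 1 & c < rnorm (f x).
Proof.
move=> /(sup_gt (unit_ball_image0 f))[_ [x /unit_ballE x1 <-] cx].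
by exists x.
Qed.

Lemma rnorm_le_opnorm (f : {linear X -> Y}) x : continuous f ->
  rnorm (f x) <= opnorm f * rnorm x.
Proof.
move=> /continuous_linear_rnorm[M _ fM].
have [->|x0] := eqVneq x 0; first by rewrite linear0 !rnorm0 mulr0.
have nx : 0 < rnorm x by exact: rnorm_gt0.
have nx' : 0 <= (rnorm x)^-1 by rewrite invr_ge0 ltW.
have : rnorm (f (scalar_inj (rnorm x)^-1 *: x)) <= opnorm f.
  by apply: (opnorm_ge fM); rewrite rnormZ_inj// mulVf ?gt_eqF.
by rewrite linearZ/= rnormZ_inj// mulrC ler_pdivrMr.
Qed.

End operator_norm.

(** * Lushness implies the alternative Daugavet property *)

Section alternative_Daugavet.
Variables (R : realType) (k : scalar_kind).
Local Notation K := (scalar_field R k).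
Variables (X Y : normedModType K) (G : {linear X -> Y}).
Hypotheses (G_continuous : continuous G) (G1 : opnorm G = 1).

Lemma rnorm_norm_one x : rnorm (G x) <= rnorm x.
Proof. by have := rnorm_le_opnorm x G_continuous; rewrite G1 mul1r. Qed.

Lemma rnorm_perturbed_le (T : {linear X -> Y}) (w : K) x : continuous T ->
  `|w| = 1 -> rnorm x <= 1 -> rnorm (G x + w *: T x) <= 1 + opnorm T.
Proof.
move=> cT w1 x1; apply: le_trans (ler_rnormD _ _) _.
rewrite rnormZ_unit// lerD ?(le_trans (rnorm_norm_one x))//.
by have [M _ TM] := continuous_linear_rnorm cT; exact: opnorm_ge TM x1.
Qed.

Lemma opnorm_perturbed_le (T : {linear X -> Y}) (w : K) : continuous T ->
  `|w| = 1 -> opnorm (fun x => G x + w *: T x) <= 1 + opnorm T.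
Proof. by move=> cT w1; apply: opnorm_le => x; exact: rnorm_perturbed_le. Qed.

(** Compare with [a + y] when [t <= 1], at the cost [1 - t], and with [t] times [a + y] when
    [t >= 1], at the cost [t - 1]. This carries the lushness estimate from [y] to its positive
    multiples. *)
Lemma rnorm_perturbed_scale (a y : Y) (t e : R) : rnorm a <= 1 -> rnorm y = 1 ->
  0 <= t -> 0 <= e -> 2 - e <= rnorm (a + y) ->
  1 + t - (1 + t) * e <= rnorm (a + scalar_inj t *: y).
Proof.
move=> a1 y1 t0 e0 aye; have [t1|/ltW t1] := leP t 1.
  have := ler_rnorm_dist (a + y) (a + scalar_inj t *: y).
  rewrite opprD addrACA subrr add0r -[X in X - _ *: y]scale1r -scalerBl.
  rewrite -[X in X - _](rmorph1 scalar_inj) -rmorphB rnormZ_inj ?subr_ge0// y1 mulr1.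
  by nra.
have := ler_rnorm_dist (scalar_inj t *: (a + y)) (a + scalar_inj t *: y).
rewrite scalerDr opprD addrACA subrr addr0 -scalerDr -[X in _ *: a - X]scale1r -scalerBl.
rewrite -[X in _ - X](rmorph1 scalar_inj) -rmorphB !rnormZ_inj ?subr_ge0//.
by nra.
Qed.

Lemma lush_alternative_Daugavet : lush G -> alternative_Daugavet G.
Proof.
move=> lG T cT [y0 y0n0 rT].
set S := [set _ | _ in _].
have S0 : S !=set0.
  exists (opnorm (fun x => G x + 1 *: T x)), 1 => //=.
  by rewrite /unit_scalars/= normr1.
have Sub : ubound S (1 + opnorm T).
  by move=> _ [w w1 <-]; exact: opnorm_perturbed_le.
apply/eqP; rewrite eq_le; apply/andP; split; first exact: ge_sup.
set N := opnorm T; have N0 : 0 <= N.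
  have [M _ TM] := continuous_linear_rnorm cT.
  by have := @opnorm_ge _ _ _ _ T M 0 TM; rewrite rnorm0 linear0 rnorm0 => ->.
apply/ler_addgt0Pr => e e0.
suff [w [x [w1 x1 wx]]] : exists w x, [/\ `|w| = 1, rnorm x <= 1 &
    1 + N - e <= rnorm (G x + w *: T x)].
  rewrite -lerBlDr; apply: le_trans wx _.
  apply: (@le_trans _ _ (opnorm (fun x => G x + w *: T x))).
    have [M _ TM] := continuous_linear_rnorm cT.
    apply: (@opnorm_ge _ _ _ _ (fun x => G x + w *: T x) (1 + M)) => // v.
    apply: le_trans (ler_rnormD _ _) _.
    by rewrite rnormZ_unit// mulrDl mul1r lerD// rnorm_norm_one.
  by apply: ub_le_sup; [exists (1 + N)|exists w].
have ny0 := rnorm_gt0 y0n0.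
pose y := scalar_inj (rnorm y0)^-1 *: y0.
have y1 : rnorm y = 1 by rewrite rnormZ_inj ?invr_ge0 1?ltW// mulVf ?gt_eqF.
have yn0 : y != 0 by apply: contra_eq_neq y1 => ->; rewrite rnorm0 eq_sym oner_eq0.
(* The range of [T] is the line through [y], so [T] is a linear form [c] times [y]. *)
have /choice[c Tc] : forall x, exists a : K, T x = a *: y.
  move=> x; have : range T (T x) by exists x.
  rewrite rT => -[a _ <-]; exists (a * scalar_inj (rnorm y0)).
  by rewrite scalerA -mulrA -rmorphM divff ?gt_eqF// rmorph1 mulr1.
have yI a b : a *: y = b *: y -> a = b.
  move=> /eqP; rewrite -subr_eq0 -scalerBl scaler_eq0 (negbTE yn0) orbF subr_eq0.
  by move=> /eqP.
have cD v v' : c (v + v') = c v + c v'.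
  by apply: yI; rewrite scalerDl -!Tc linearD.
have cZ a v : c (a *: v) = a * c v.
  by apply: yI; rewrite -scalerA -!Tc linearZ.
have Tn v : rnorm (T v) = scalar_re `|c v| by rewrite Tc rnormZ y1 mulr1.
have [x0 x01 Tx0] : exists2 x, rnorm x <= 1 & N - e / 2 < rnorm (T x).
  by apply: lt_opnorm; rewrite ltrBlDr ltrDl divr_gt0.
have [w w1 wc] := exists_scalar_phase (c x0).
pose u v := scalar_re (w * c v).
have uT v : u v <= rnorm (T v).
  by rewrite Tn /u; apply: le_trans (scalar_re_le_norm _) _; rewrite normrM w1 mul1r.
(* Replacing [x0] by [z] will lose [N * e'], and the lushness estimate at most [(1 + N) * e'];
   together these make [e / 2]. *)
pose e' := e / (2 * (1 + 2 * N)).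
have N1 : 0 < 1 + 2 * N by rewrite ltr_pwDl// mulr_ge0.
have e'0 : 0 < e' by rewrite divr_gt0// mulr_gt0.
have e'N : e' * (1 + 2 * N) = e / 2 by rewrite /e' invfM mulrA divfK// gt_eqF.
have Bx0 : unit_ball X x0 by exact/unit_ballE.
have Sy : unit_sphere Y y by exact/unit_sphereE.
have [F [FB FG]] := lG x0 e' y Bx0 e'0 Sy.
move=> /dist_to_set_lt[z Fz x0z].
have uz : N - e / 2 - N * e' < u z.
  have -> : u z = u x0 - u (x0 - z).
    have <- : u (x0 - z) + u z = u x0 by rewrite /u -raddfD -mulrDr -cD subrK.
    by rewrite addrC addKr.
  have -> : u x0 = rnorm (T x0) by rewrite /u wc Tn.
  have := uT (x0 - z); have := rnorm_le_opnorm (x0 - z) cT.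
  rewrite -/N; nra.
(* The half-space argument passes from [z] to a unimodular multiple of a point of [F]. *)
have [||_ [a a1 [x Fx <-]] uax] := convex_hull_gt _ _ Fz uz.
- by move=> v v'; rewrite /u cD mulrDr raddfD.
- by move=> r v; rewrite /u cZ mulrCA scalar_re_injM.
have Tx : N - e / 2 - N * e' < rnorm (T x).
  by apply: lt_le_trans uax _; apply: le_trans (uT _) _; rewrite linearZ rnormZ_unit.
have x1 : rnorm x <= 1 by exact/unit_ballE/FB.
(* A new phase makes [b *: T x] a nonnegative multiple of [y]. *)
have [b b1 bc] := exists_scalar_phase (c x).
exists b, x; split=> //.
have -> : b *: T x = scalar_inj (rnorm (T x)) *: y.
  by rewrite {1}Tc scalerA bc Tn scalar_reK.
have [_ xy] := FG _ (sub_convex_hull Fx).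
have TN : rnorm (T x) <= N.
  by have [M _ TM] := continuous_linear_rnorm cT; exact: opnorm_ge TM x1.
have := rnorm_perturbed_scale (le_trans (rnorm_norm_one x) x1) y1
  (rnorm_ge0 (T x)) (ltW e'0) (ltW xy).
have : rnorm (T x) * e' <= N * e' by rewrite ler_wpM2r// ltW.
by lra.
Qed.
End alternative_Daugavet.

(** * Density of the absolutely convex hulls of norming sets *)

Section norming_set.
Variables (R : realType) (k : scalar_kind).
Local Notation K := (scalar_field R k).
Variables (X Y : normedModType K) (G : {linear X -> Y}).
Hypotheses (G_continuous : continuous G) (G1 : opnorm G = 1).
Implicit Types (u : Y) (e d : R).

Definition norming_set u e : set X :=
  [set x | rnorm x <= 1 /\ 1 + rnorm u - e < rnorm (G x + u)].

(** Passing from [v] to [u] changes both [rnorm v] and [rnorm (G x + v)] by at most [rnorm (u - v)],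
    whence the factor 2. *)
Lemma sub_norming_set u v e d : 2 * rnorm (u - v) + d <= e ->
  norming_set v d `<=` norming_set u e.
Proof.
move=> uvde x [x1 xv]; split=> //.
have := ler_rnorm_dist (G x + v) (G x + u).
rewrite opprD addrACA subrr add0r rnorm_distC => xvu.
have := ler_rnorm_dist u v; lra.
Qed.

Hypothesis aG : alternative_Daugavet G.

(** Apply the alternative Daugavet property to the rank-one operator sending [x] to [f x *: u], and
    rotate a point that almost attains the supremum. *)
Lemma norming_set_meets_slice (f : {linear X -> K^o}) u e x0 :
  continuous f -> u != 0 -> 0 < e -> rnorm x0 <= 1 -> 1 < scalar_re (f x0) ->
  exists x w, [/\ norming_set u e x, `|w| = 1 & 1 < scalar_re (f (w *: x))].
Proof.
move=> cf u0 e0 x01 fx0; have nu := rnorm_gt0 u0.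
have Tlin : linear (fun x => f x *: u : Y).
  by move=> a v v'; rewrite linearP scalerDl scalerA.
pose Tl := GRing.isLinear.Build K X Y _ (fun x => f x *: u : Y) Tlin.
pose T : {linear X -> Y} := HB.pack_for {linear X -> Y} (fun x => f x *: u : Y) Tl.
have TE x : T x = f x *: u by [].
have [M _ fM] := continuous_linear_rnorm cf.
have TM x : rnorm (T x) <= (M * rnorm u) * rnorm x.
  by rewrite TE rnormZ -[scalar_re _]/(rnorm (f x)) mulrAC ler_wpM2r ?fM// rnorm_ge0.
have cT : continuous T by exact: linear_rnorm_continuous TM.
have fx00 : f x0 != 0.
  by apply: contraTneq fx0 => ->; rewrite raddf0 -leNgt ler01.
have rT : rank_one T.
  exists u => //; apply/seteqP; split=> [_ [x _ <-]|_ [a _ <-]]; first by exists (f x).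
  by exists ((a / f x0) *: x0) => //; rewrite TE linearZ /= -[_ *: f x0]/(_ * _) divfK.
have aT := aG cT rT; set S := [set _ | _ in _] in aT.
have S0 : S !=set0.
  by exists (opnorm (fun x => G x + 1 *: T x)), 1 => //=; rewrite /unit_scalars/= normr1.
(* The second bound forces the modulus of [f] to exceed 1 at any point within [d] of the
   supremum. *)
pose d := Num.min e ((scalar_re (f x0) - 1) * rnorm u).
have d0 : 0 < d by rewrite lt_min e0 mulr_gt0// subr_gt0.
have de : d <= e by rewrite ge_min lexx.
have df : d <= (scalar_re (f x0) - 1) * rnorm u by rewrite ge_min lexx orbT.
have : 1 + opnorm T - d < sup S by rewrite aT ltrBlDr ltrDl.
move=> /(sup_gt S0)[_ [w w1 <-]] /lt_opnorm[x x1 wx].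
have Tx0 : scalar_re (f x0) * rnorm u <= opnorm T.
  apply: le_trans (opnorm_ge TM x01).
  by rewrite TE rnormZ ler_wpM2r ?rnorm_ge0// scalar_re_le_norm.
have Tx := opnorm_ge TM x1; rewrite TE rnormZ in Tx.
have fx : 1 < scalar_re `|f x|.
  rewrite -(ltr_pM2r nu) mul1r.
  have := ler_rnormD (G x) (w *: T x); rewrite (rnormZ_unit _ w1) TE rnormZ.
  by have := rnorm_norm_one G_continuous G1 x; lra.
(* After rotation by [b] the perturbation is a multiple of [u] with factor above 1; removing the
   excess over [u] itself costs exactly its norm. *)
have [b b1 bf] := exists_scalar_phase (w * f x).
have bfE : b * (w * f x) = scalar_inj (scalar_re `|f x|).
  by rewrite bf normrM w1 mul1r scalar_reK.
exists (b *: x), w; split=> //; last first.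
  rewrite !linearZ/= -[w *: _]/(w * (b * f x)) mulrCA bfE.
  by rewrite scalar_injK.
split; first by rewrite rnormZ_unit.
move: wx; rewrite -(rnormZ_unit _ b1) scalerDr TE !scalerA -mulrA bfE -linearZ/=.
set t := scalar_re `|f x| in fx Tx * => wx.
have t1 : 0 <= t - 1 by rewrite subr_ge0 ltW.
have := ler_rnorm_dist (G (b *: x) + scalar_inj t *: u) (G (b *: x) + u).
rewrite opprD addrACA subrr add0r -[X in _ - X]scale1r -scalerBl.
rewrite -[X in _ - X](rmorph1 scalar_inj) -rmorphB rnormZ_inj//; lra.
Qed.

(** Separating a nonzero vector of the ball from 0 supplies a functional for the slice argument. *)
Lemma norming_set_nonempty u e : u != 0 -> 0 < e -> norming_set u e !=set0.
Proof.
move=> u0 e0; have [v v1 v0] : exists2 v : X, rnorm v <= 1 & 0 < rnorm (G v).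
  by apply: lt_opnorm; rewrite G1.
have vn0 : v != 0 by apply: contraTneq v0 => ->; rewrite linear0 rnorm0 ltxx.
have [|||f [cf _ fv]] := @convex_separation R k X [set 0] v.
- by apply/convex_setE => _ _ t -> -> _ _; rewrite !scaler0 addr0.
- by [].
- move=> /closure_rnorm/(_ _ (rnorm_gt0 vn0))[_ ->].
  by rewrite subr0 ltxx.
by have [x [w [xE _ _]]] := norming_set_meets_slice cf u0 e0 v1 fv; exists x.
Qed.

Let norming_set_aconvex_dense_neq0 u e x : u != 0 -> 0 < e -> rnorm x <= 1 ->
  closure (aconvex_hull (norming_set u e)) x.
Proof.
move=> u0 e0 x1; apply: contrapT => nx.
have [z zE] := norming_set_nonempty u0 e0.
(* Separation asks for 0 in the convex set; it is the midpoint of [z] and [- z]. *)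
have hull0 : aconvex_hull (norming_set u e) 0.
  have /convex_setE/(_ z (- z) 2^-1) :=
    @convex_hull_convex R k X
      [set w *: v | w in @unit_scalars R k & v in norming_set u e].
  rewrite scalerN.
  have -> : 1 - 2^-1 = 2^-1 :> R by lra.
  rewrite subrr; apply; rewrite ?invr_ge0//; last by lra.
    by apply: sub_convex_hull; exists 1; [exact: normr1|exists z => //; rewrite scale1r].
  by apply: sub_convex_hull; exists (-1);
    [rewrite /unit_scalars/= normrN1|exists z => //; rewrite scaleN1r].
have [f [cf fC fx]] := convex_separation (@convex_hull_convex _ _ _ _) hull0 nx.
have [v [w [vE w1]]] := norming_set_meets_slice cf u0 e0 x1 fx.
by rewrite ltNge fC//; apply: sub_convex_hull; exists w => //; exists v.
Qed.

(** The rank-one argument requires a nonzero [u], so 0 is replaced by a vector of norm [e / 4] with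
    tolerance [e / 2]. *)
Lemma norming_set_aconvex_dense u e x : 0 < e -> rnorm x <= 1 ->
  closure (aconvex_hull (norming_set u e)) x.
Proof.
move=> e0 x1; have [->|u0] := eqVneq u 0; last exact: norming_set_aconvex_dense_neq0.
have [v _ v0] : exists2 v : X, rnorm v <= 1 & 0 < rnorm (G v).
  by apply: lt_opnorm; rewrite G1.
pose s := e / 4 / rnorm (G v).
have s0 : 0 < s by rewrite !divr_gt0.
have nsv : rnorm (scalar_inj s *: G v) = e / 4 by rewrite rnormZ_inj ?ltW// divfK// gt_eqF.
have sv0 : scalar_inj s *: G v != 0.
  by apply: contra_eq_neq nsv => ->; rewrite rnorm0 eq_sym gt_eqF ?divr_gt0.
have e20 : 0 < e / 2 by rewrite divr_gt0.
have := norming_set_aconvex_dense_neq0 sv0 e20 x1; apply: closureS.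
by apply: aconvex_hullS; apply: sub_norming_set; rewrite sub0r rnormN nsv; lra.
Qed.

End norming_set.

(** * Countable closures and countable support of hull points *)

Section countable_reduction.
Variables (R : realType) (k : scalar_kind).
Local Notation K := (scalar_field R k).

Lemma countable_setU (T : Type) (A B : set T) :
  countable A -> countable B -> countable (A `|` B).
Proof.
move=> cA cB; rewrite -bigcup2E.
by apply: bigcup_countable => [|[|[|i]] _]//=; exact: countableP.
Qed.

Lemma exists_natSinv_lt (e : R) : 0 < e -> exists n, n.+1%:R^-1 < e.
Proof.
by move=> e0; have [n _ /(_ n (leqnn n))] := near_infty_natSinv_lt (PosNum e0); exists n.
Qed.

(** Iterate [next] countably often: two members of the union already lie in a common stage, and the
    next stage contains their [op]. *)
Lemma countable_op_closure (T : Type) (op : T -> T -> set T) (D0 : set T) :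
  countable D0 -> (forall x z, countable (op x z)) ->
  exists D, [/\ countable D, D0 `<=` D &
    forall x z, D x -> D z -> op x z `<=` D].
Proof.
move=> cD0 cop.
pose next D := D `|` \bigcup_(x in D) \bigcup_(z in D) op x z.
pose D_ n := iter n next D0.
have Dinc m n : (m <= n)%N -> D_ m `<=` D_ n.
  elim: n => [|n IHn]; first by rewrite leqn0 => /eqP->.
  rewrite leq_eqVlt => /predU1P[->//|/IHn Dmn].
  by apply: subset_trans Dmn _ => x; left.
exists (\bigcup_n D_ n); split; last 2 first.
- by move=> x D0x; exists 0.
- move=> x z [m _ Dmx] [n _ Dnz] v xzv; exists (maxn m n).+1 => //=; right.
  exists x; first exact: Dinc (leq_maxl _ _) _ Dmx.
  by exists z => //; exact: Dinc (leq_maxr _ _) _ Dnz.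
apply: bigcup_countable; first exact: countableP.
move=> n _; elim: n => //= n IHn; apply: countable_setU => //.
by apply: bigcup_countable => // x _; exact: bigcup_countable.
Qed.

Variable X : normedModType K.

(** The hull is a smallest convex set, so it suffices that the points with countable support form a
    convex set containing the generators. *)
Lemma aconvex_hull_countable (A : set X) x : aconvex_hull A x ->
  exists B, [/\ countable B, B `<=` A & aconvex_hull B x].
Proof.
suff : aconvex_hull A `<=` [set x | exists B,
    [/\ countable B, B `<=` A & aconvex_hull B x]].
  exact.
apply: convex_hull_min => [|_ [w w1 [v Av <-]]]; last first.
  exists [set v]; split; [exact: countable1|by move=> _ ->|].
  by apply: sub_convex_hull; exists w => //; exists v.
apply/convex_setE => v v' t [B [cB BA Bv]] [B' [cB' BA' Bv']] t0 t1.
exists (B `|` B'); split.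
- exact: countable_setU.
- by rewrite subUset.
- move/convex_setE : (@convex_hull_convex R k X
      [set w *: x | w in @unit_scalars R k & x in B `|` B']).
  apply => //; first by apply: aconvex_hullS Bv => ?; left.
  by apply: aconvex_hullS Bv' => ?; right.
Qed.

Lemma closure_aconvex_hull_countable (A : set X) x : closure (aconvex_hull A) x ->
  exists B, [/\ countable B, B `<=` A & closure (aconvex_hull B) x].
Proof.
move=> /closure_rnorm Ax.
have /choice[B BP] : forall n, exists B, [/\ countable B, B `<=` A &
    exists2 y, aconvex_hull B y & rnorm (x - y) < n.+1%:R^-1].
  move=> n; have [|y Ay xy] := Ax n.+1%:R^-1; first by rewrite invr_gt0.
  by have [B [cB BA By]] := aconvex_hull_countable Ay; exists B; split=> //; exists y.
exists (\bigcup_n B n); split.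
- by apply: bigcup_countable => [|n _]; [exact: countableP|by have [] := BP n].
- by apply: bigcup_sub => n _; have [] := BP n.
- apply/closure_rnorm => e e0; have [n ne] := exists_natSinv_lt e0.
  have [_ _ [y By xy]] := BP n; exists y; last exact: lt_trans ne.
  by apply: aconvex_hullS By; exact: bigcup_sup.
Qed.

(** Approximants of points of the ball may lie outside it; this radial map moves them inside and at
    most doubles the error. *)
Definition ball_retraction (x : X) : X := scalar_inj (Num.max 1 (rnorm x))^-1 *: x.

Lemma rnorm_ball_retraction x : rnorm (ball_retraction x) <= 1.
Proof.
have m0 : 0 < Num.max 1 (rnorm x) by rewrite lt_max ltr01.
rewrite rnormZ_inj ?invr_ge0 ?(ltW m0)// mulrC ler_pdivrMr// mul1r.
by rewrite le_max lexx orbT.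
Qed.

Lemma ball_retraction_dist x v : rnorm v <= 1 ->
  rnorm (v - ball_retraction x) <= 2 * rnorm (v - x).
Proof.
move=> v1; rewrite /ball_retraction.
have [x1|x1] := leP (rnorm x) 1.
  by rewrite invr1 rmorph1 scale1r; have := rnorm_ge0 (v - x); lra.
have := ler_rnorm_dist (v - scalar_inj (rnorm x)^-1 *: x) (v - x).
rewrite opprB [v - _]addrC addrAC addrA subrK.
have x0 : 0 < rnorm x by lra.
have -> : - (scalar_inj (rnorm x)^-1 *: x) + x = scalar_inj (1 - (rnorm x)^-1) *: x.
  by rewrite rmorphB rmorph1 scalerBl scale1r addrC.
rewrite rnormZ_inj ?subr_ge0 ?invf_le1 ?(ltW x1)// mulrBl mul1r mulVf ?gt_eqF//.
by have := ler_rnorm_dist x v; rewrite rnorm_distC; lra.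
Qed.

Lemma closure_closed_subspace (D Q : set _) :
  (forall z (e : R), 0 < e -> exists2 q : K, Q q & scalar_re `|z - q| < e) ->
  D (0 : X) -> (forall q x z, Q q -> D x -> D z -> D (q *: x + z)) ->
  closed_subspace (closure D).
Proof.
move=> Qdense D0 Dop; split=> [||a x z /closure_rnorm Dx /closure_rnorm Dz].
- exact: closed_closure.
- exact: subset_closure.
apply/closure_rnorm => e e0.
have [|z' Dz' zz'] := Dz (e / 3); first by rewrite divr_gt0.
have a0 : 0 <= scalar_re `|a| by exact: (@rnorm_ge0 R k K^o a).
(* [x'] is chosen before [q], whose tolerance depends on the norm of [x']. *)
have [|x' Dx' xx'] := Dx (e / 3 / (1 + scalar_re `|a|)); first by rewrite !divr_gt0// ltr_pwDl.
have x0 := rnorm_ge0 x'.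
have [|q Qq aq] := Qdense a (e / 3 / (1 + rnorm x')); first by rewrite !divr_gt0// ltr_pwDl.
exists (q *: x' + z'); first exact: Dop.
rewrite ltr_pdivlMr ?ltr_pwDl// in xx'; rewrite ltr_pdivlMr ?ltr_pwDl// in aq.
have -> : a *: x + z - (q *: x' + z') = a *: (x - x') + (a - q) *: x' + (z - z').
  rewrite scalerBr scalerBl opprD !addrA; congr (_ - _).
  by rewrite subrK addrAC.
apply: le_lt_trans (ler_rnormD _ _) _.
have := ler_rnormD (a *: (x - x')) ((a - q) *: x').
rewrite !rnormZ; have := rnorm_ge0 (x - x'); have := @rnorm_ge0 R k K^o (a - q).
rewrite -[rnorm (a - q : K^o)]/(scalar_re `|a - q|); nra.
Qed.

End countable_reduction.

(** * A separable subspace adapted to [G] and [y] *)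

Section separable_reduction.
Variables (R : realType) (k : scalar_kind).
Local Notation K := (scalar_field R k).
Variables (X Y : normedModType K) (G : {linear X -> Y}).
Hypotheses (G_continuous : continuous G) (G1 : opnorm G = 1).
Hypothesis aG : alternative_Daugavet G.

Lemma separable_reduction (x0 : X) (y : Y) : exists X0 : set X,
  [/\ closed_subspace X0, separable_set X0, X0 x0 &
    forall x z e, X0 x -> X0 z -> rnorm x <= 1 -> 0 < e ->
      closure (aconvex_hull (norming_set G (G z + y) e `&` X0)) x].
Proof.
have [Q cQ Qdense] := countable_dense_scalars R k.
have /choice[W WP] : forall p : X * X * nat, exists B, [/\ countable B,
    B `<=` norming_set G (G p.1.2 + y) p.2.+1%:R^-1 &
    closure (aconvex_hull B) (ball_retraction p.1.1)].
  move=> p; apply: closure_aconvex_hull_countable.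
  by apply: norming_set_aconvex_dense => //; exact: rnorm_ball_retraction.
(* Closing under [op] gives a dense part of a subspace and also keeps all the countable witnesses
   [W] inside it. *)
pose op x z := [set q *: x + z | q in Q] `|` \bigcup_n W (x, z, n).
have [|x z|D [cD D0 Dop]] := @countable_op_closure X op [set 0; x0].
- exact: countable_setU (countable1 _) (countable1 _).
- apply: countable_setU.
    exact: sub_countable (card_image_le _ _) cQ.
  by apply: bigcup_countable => [|n _]; [exact: countableP|have [] := WP (x, z, n)].
exists (closure D); split.
- apply: closure_closed_subspace Qdense _ _; first by apply: D0; left.
  by move=> q x z Qq Dx Dz; apply: (Dop x z) => //; left; exists q.
- by exists D; split=> //; exact: subset_closure.
- by apply/subset_closure/D0; right.
move=> x z e /closure_rnorm Dx /closure_rnorm Dz x1 e0.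
apply/closure_rnorm => r r0.
have [|d Dd xd] := Dx (r / 4); first by rewrite divr_gt0.
(* The change of [z] into [d'] counts twice, which leaves [e / 2] for the tolerance of the norming
   set. *)
have [|d' Dd' zd'] := Dz (e / 4); first by rewrite divr_gt0.
have [n ne] : exists n, n.+1%:R^-1 < e / 2 by apply: exists_natSinv_lt; rewrite divr_gt0.
have [_ WE /closure_rnorm Wd] := WP (d, d', n).
have [|p Wp dp] := Wd (r / 2); first by rewrite divr_gt0.
exists p.
  apply: aconvex_hullS Wp; rewrite subsetI; split; last first.
    by move=> v Wv; apply/subset_closure/(Dop d d') => //; right; exists n.
  apply: subset_trans WE _; apply: sub_norming_set => /=.
  have -> : G z + y - (G d' + y) = G (z - d').
    by rewrite linearB opprD addrACA subrr addr0.
  have bound a b c : a <= b -> b < e / 4 -> c < e / 2 -> 2 * a + c <= e by lra.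
  exact: bound (rnorm_norm_one G_continuous G1 (z - d')) zd' ne.
have := ler_rnormD (x - ball_retraction d) (ball_retraction d - p).
rewrite addrA subrK => /le_lt_trans; apply.
by have := ball_retraction_dist d x1; lra.
Qed.

End separable_reduction.

(** * The alternative Daugavet property implies lushness *)

Section lushness.
Variables (R : realType) (k : scalar_kind).
Local Notation K := (scalar_field R k).
Variables (X Y : normedModType K) (G : {linear X -> Y}).
Hypotheses (G_continuous : continuous G) (G1 : opnorm G = 1).

(** A point of the hull close to a point of the slice exceeds the threshold of the slice; by the
    half-space argument so does a generator, which lies in [A]. *)
Lemma slice_meets_aconvex_dense (A S E : set X) : A !=set0 -> is_slice A S ->
  (forall x, A x -> closure (aconvex_hull E) x) ->
  (forall w x, `|w| = 1 -> E x -> A (w *: x)) ->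
  exists x w, [/\ E x, `|w| = 1 & S (w *: x)].
Proof.
move=> [a0 Aa0] [f [a [cf a_gt0 ->]]] Adense AE.
set c := sup _ - a.
have [_ [x Ax <-] cx] : exists2 r, [set scalar_re (f z) | z in A] r & c < r.
  by apply: sup_gt; [exists (scalar_re (f a0)), a0|rewrite ltrBlDr ltrDl].
have [M M0 fM] := continuous_linear_rnorm cf.
have /closure_rnorm/(_ ((scalar_re (f x) - c) / M)) [|p Ep xp] := Adense _ Ax.
  by rewrite divr_gt0// subr_gt0.
have cp : c < scalar_re (f p).
  rewrite ltr_pdivlMr// mulrC in xp.
  have := scalar_re_le_norm (f (x - p)); rewrite -[X in _ <= X]/(rnorm (f (x - p) : K^o)).
  have := fM (x - p); have := raddfB (@scalar_re R k) (f x) (f p); rewrite -linearB => ->.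
  by lra.
have [v v'|r v|_ [w w1 [v Ev <-]] cv] :=
  convex_hull_gt (f := fun v => scalar_re (f v)) _ _ Ep cp.
- by rewrite linearD raddfD.
- by rewrite linearZ; exact: scalar_re_injM.
by exists v, w; split=> //; split => //; exact: AE.
Qed.

(* Points [Z n - v] within [n - 1] of [0] lose at most [n - 1] of the norm
   [n + 1] of [y + G (Z n)]; averages of the summands of [Z n] have this
   property. *)
Lemma convex_hull_near_norming (e : R) (y : Y) (x Z : nat -> X) :
  (forall n, rnorm (x n) <= 1) -> Z 0%N = 0 -> (forall n, Z n.+1 = x n + Z n) ->
  (forall n, n.+1%:R - e < rnorm (G (Z n) + y)) ->
  convex_hull (range x) `<=` [set v | unit_ball X v /\ 2 - e < rnorm (G v + y)].
Proof.
move=> x1 Z0 ZS ZG.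
pose C := [set v | unit_ball X v /\
  exists N, forall n, (N <= n)%N -> rnorm (Z n - v) <= n%:R - 1].
have CG : C `<=` [set v | unit_ball X v /\ 2 - e < rnorm (G v + y)].
  move=> v [v1 [N /(_ N (leqnn N)) NZ]]; split=> //.
  have := ler_rnorm_dist (G (Z N) + y) (G v + y).
  rewrite opprD addrACA subrr addr0 -linearB.
  have := ZG N; rewrite -natr1; have := rnorm_norm_one G_continuous G1 (Z N - v).
  move: NZ; lra.
apply: subset_trans CG; apply: convex_hull_min.
  apply/convex_setE => v v' t [v1 [N vN]] [v'1 [N' v'N]] t0 t1; split.
    by move/convex_setE : (@convex_unit_ball R k X); apply.
  exists (maxn N N') => n; rewrite geq_max => /andP[/vN vn /v'N v'n].
  have -> : Z n - (scalar_inj t *: v + scalar_inj (1 - t) *: v') =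
      scalar_inj t *: (Z n - v) + scalar_inj (1 - t) *: (Z n - v').
    rewrite !scalerBr addrACA -scalerDl -rmorphD.
    by rewrite [t + _]addrC subrK rmorph1 scale1r -opprD.
  apply: le_trans (ler_rnormD _ _) _; rewrite !rnormZ_inj ?subr_ge0//; nra.
move=> _ [i _ <-]; split; first exact/unit_ballE.
have Zn n : rnorm (Z n) <= n%:R.
  elim: n => [|n IHn]; first by rewrite Z0 rnorm0.
  by rewrite ZS -natr1 addrC; apply: le_trans (ler_rnormD _ _) _; rewrite lerD.
(* From index [i.+1] on, [x i] is a summand of [Z n], and the other [n - 1] summands lie in the
   ball. *)
exists i.+1; elim=> // n IHn; rewrite leq_eqVlt => /predU1P[[->]|].
  by rewrite ZS addrAC subrr add0r -natr1 addrK.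
move=> /IHn Zin; rewrite ZS -addrA -natr1 addrAC [leRHS]addrC.
by apply: le_trans (ler_rnormD _ _) _; rewrite lerD.
Qed.

Lemma alternative_Daugavet_lush :
  (forall X0 : set X, closed_subspace X0 -> separable_set X0 -> SCD (X0 `&` unit_ball X)) ->
  alternative_Daugavet G -> lush G.
Proof.
move=> X_SCD aG x0 e y x0B e0 /unit_sphereE y1.
have [X0 [sX0 sepX0 X0x0 X0dense]] := separable_reduction G_continuous G1 aG x0 y.
have [_ [S [slS SCDS]]] := X_SCD _ sX0 sepX0.
case: sX0 => _ X00 X0lin.
have X0Z w v : X0 v -> X0 (w *: v) by move=> X0v; rewrite -(addr0 (w *: v)); exact: X0lin.
(* At stage [n] with partial sum [z], [g] picks the next vector and its phase; [(0, 0)] is a default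
   for [z] outside [X0]. The tolerances [e / 2 ^+ n.+1] sum to [e]. *)
have /choice[g gP] : forall p : nat * X, exists q : X * K, X0 p.2 ->
    [/\ X0 q.1, norming_set G (G p.2 + y) (e / 2 ^+ p.1.+1) q.1, `|q.2| = 1 &
      S p.1 (q.2 *: q.1)].
  move=> [n z]; have [X0z|] := pselect (X0 z); last by exists (0, 0).
  have [||v Av||v [w [[vE X0v] w1 Sv]]] := @slice_meets_aconvex_dense
      (X0 `&` unit_ball X) (S n) (norming_set G (G z + y) (e / 2 ^+ n.+1) `&` X0).
  - by exists 0; split=> //; apply/unit_ballE; rewrite rnorm0.
  - exact: slS.
  - case: Av => X0v /unit_ballE v1; apply: X0dense => //.
    by rewrite divr_gt0// exprn_gt0.
  - move=> w v w1 [[v1 _] X0v]; split; first exact: X0Z.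
    by apply/unit_ballE; rewrite rnormZ_unit.
  by exists (v, w).
pose Z := fix Z n := if n is n'.+1 then (g (n', Z n')).1 + Z n' else 0.
pose x n := (g (n, Z n)).1; pose w n := (g (n, Z n)).2.
have ZX0 n : X0 (Z n).
  elim: n => //= n IHn; have [X0x _ _ _] := gP (n, Z n) IHn.
  by rewrite -[(g _).1]scale1r; exact: X0lin.
have xP n := gP (n, Z n) (ZX0 n).
(* Each step adds 1 up to its tolerance, starting from [rnorm y = 1]; the geometric sum stays
   strictly below [e]. *)
have Znorm n : n.+1%:R - e * (1 - (2 ^+ n)^-1) <= rnorm (G (Z n) + y).
  elim: n => [|n IHn].
    by rewrite linear0 add0r y1 expr0 invr1 subrr mulr0 subr0.
  have xn : 1 + rnorm (G (Z n) + y) - e / 2 ^+ n.+1 < rnorm (G (x n) + (G (Z n) + y)).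
    by have [_ [_ ?] _ _] := xP n.
  have -> : G (Z n.+1) + y = G (x n) + (G (Z n) + y) by rewrite linearD addrA.
  apply: le_trans _ (ltW xn).
  have -> : n.+2%:R = n.+1%:R + 1 :> R by rewrite natr1.
  rewrite exprS invfM; move: IHn; set q := (2 ^+ n)^-1; lra.
have xB n : rnorm (x n) <= 1 by have [_ []] := xP n.
exists (range x); split.
- by move=> _ [n _ <-]; exact/unit_ballE.
- apply: (@convex_hull_near_norming _ _ _ Z) => // n.
  apply: lt_le_trans (Znorm n).
  by rewrite mulrBr mulr1 opprB addrA ltrBlDr subrK ltrDl mulr_gt0// invr_gt0 exprn_gt0.
- apply/dist_to_set_lt.
  (* The SCD property is applied to the rotated points, whose convex hull lies in the absolutely
     convex hull of the [x n]. *)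
  have Bslice n : range (fun n => w n *: x n) `&` S n !=set0.
    by exists (w n *: x n); split; [exists n|have [] := xP n].
  have /closure_rnorm/(_ e e0)[z Bz x0z] := SCDS _ Bslice x0 (conj X0x0 x0B).
  exists z => //; apply: convex_hullS Bz => _ [n _ <-].
  by exists (w n); [have [] := xP n|exists (x n)].
Qed.

End lushness.

Theorem corollary3p28 (R : realType) (k : scalar_kind)
  (X Y : completeNormedModType (scalar_field R k))
  (G : {linear X -> Y})
  (G_continuous : continuous G)
  (G_norm_one : opnorm G = 1)
  (separable_SCD : forall X0 : set X,
     closed_subspace X0 -> separable_set X0 -> SCD (X0 `&` unit_ball X)) :
  alternative_Daugavet G <-> lush G.
Proof.
split; first exact: alternative_Daugavet_lush.
exact: lush_alternative_Daugavet.
Qed.
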